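(* Let $\Sigma,\Delta,\Gamma\in\mathcal{G}_n$ be pairwise generalized cospectral. Suppose there exist $Q,Q_1\in\mathcal{Q}(\Sigma)$ with the same level $\ell$ such that $Q^{\rm T}S(\Sigma)Q=S(\Delta)$ and $Q_1^{\rm T}S(\Sigma)Q_1=S(\Gamma)$. Then $\Delta$ is isomorphic to $\Gamma$.
   Context: An oriented graph on vertices $v_1,\dots,v_n$ is a simple graph with each edge directed. Its skew-adjacency matrix $S=(s_{ij})$ has $s_{ij}=1$ if $(v_i,v_j)$ is an arc, $-1$ if $(v_j,v_i)$ is an arc, $0$ otherwise. Two oriented graphs $\Delta,\Gamma$ are isomorphic if $S(\Delta)=P^{\rm T}S(\Gamma)P$ for a permutation matrix $P$; they are generalized cospectral if their skew-adjacency matrices have the same spectrum and the matrices $J-I-S$ have the same spectrum ($J$ all-one, $I$ identity). With $e$ the all-one vector, $W(\Sigma)=[e,Se,\dots,S^{n-1}e]$ for $S=S(\Sigma)$. $\mathcal{G}_n$ is the set of $n$-vertex oriented graphs with $2^{-\lfloor n/2\rfloor}\det W(\Sigma)$ an odd square-free integer. A rational orthogonal matrix $Q$ is regular if $Qe=e$; its level is the least positive integer $k$ with $kQ$ integral. $\mathcal{Q}(\Sigma)$ is the set of regular rational orthogonal $Q$ with $Q^{\rm T}S(\Sigma)Q=S(\Delta)$ for some oriented graph $\Delta$ generalized cospectral with $\Sigma$. *)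

(* Defs.v *)
From HB Require Import structures.
From mathcomp Require Import all_boot all_order all_fingroup all_algebra.
Set Implicit Arguments. Unset Strict Implicit. Unset Printing Implicit Defensive.
Import Order.TTheory GRing.Theory Num.Theory.
Local Open Scope ring_scope.

(* An oriented graph on vertices 'I_n is given by its arc relation:
   arc i j means (v_i, v_j) is an arc.  Simple + oriented: never both
   arc i j and arc j i (in particular no loops). *)
Definition oriented (n : nat) (arc : rel 'I_n) : Prop :=
  forall i j, arc i j -> ~~ arc j i.

Definition skewS (n : nat) (arc : rel 'I_n) : 'M[rat]_n :=
  \matrix_(i, j) (if arc i j then 1 else if arc j i then -1 else 0).

Definition Jmx (n : nat) : 'M[rat]_n := const_mx 1.
Definition evec (n : nat) : 'cV[rat]_n := const_mx 1.

Definition gen_cospectral (n : nat) (a b : rel 'I_n) : Prop :=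
  char_poly (skewS a) = char_poly (skewS b) /\
  char_poly (Jmx n - 1%:M - skewS a) = char_poly (Jmx n - 1%:M - skewS b).

Definition walk_mx (n : nat) (a : rel 'I_n) : 'M[rat]_n :=
  \matrix_(i, j) ((skewS a ^+ j *m evec n) i 0).

Definition squarefree (m : nat) : Prop :=
  forall p : nat, prime p -> ~~ (p * p %| m)%N.

Definition in_Gn (n : nat) (a : rel 'I_n) : Prop :=
  oriented a /\
  exists m : int, \det (walk_mx a) = (2 ^+ (n./2)) * m%:~R
                  /\ odd `|m|%N /\ squarefree `|m|%N.

Definition integral_mx (n : nat) (M : 'M[rat]_n) : Prop :=
  exists N : 'M[int]_n, M = map_mx (fun z : int => z%:~R) N.

Definition rat_orthogonal (n : nat) (Q : 'M[rat]_n) : Prop :=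
  Q^T *m Q = 1%:M.

Definition regular (n : nat) (Q : 'M[rat]_n) : Prop :=
  Q *m evec n = evec n.

Definition is_level (n : nat) (Q : 'M[rat]_n) (k : nat) : Prop :=
  (0 < k)%N /\ integral_mx (k%:R *: Q) /\
  forall k' : nat, (0 < k')%N -> integral_mx (k'%:R *: Q) -> (k <= k')%N.

Definition in_calQ (n : nat) (sigma : rel 'I_n) (Q : 'M[rat]_n) : Prop :=
  rat_orthogonal Q /\ regular Q /\
  exists delta : rel 'I_n, oriented delta /\ gen_cospectral sigma delta /\
     Q^T *m skewS sigma *m Q = skewS delta.

Definition isomorphic (n : nat) (delta gamma : rel 'I_n) : Prop :=
  exists s : 'S_n,
    skewS delta = (perm_mx s)^T *m skewS gamma *m perm_mx s.

(* Main.v *)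
Require Import Defs.
From HB Require Import structures.
From mathcomp Require Import all_boot all_order all_fingroup all_algebra.
From mathcomp Require Import ring zify.
Import Order.TTheory GRing.Theory Num.Theory.
Local Open Scope ring_scope.
Set Implicit Arguments. Unset Strict Implicit.

(* Put U = Q^T Q1, so that U S(Gamma) U^T = S(Delta).  It suffices that U is
   integral: an integral orthogonal matrix fixing e is a permutation matrix.
   Let R = l Q^T and R1 = l Q1^T, which are integral, and W = W(Sigma).  Since
   Q^T W(Sigma) = W(Delta), both R W and R1 W vanish mod l.

   For an odd prime p dividing l, p^2 does not divide det W, so W has corank 1
   mod p; hence p^2 does not divide l and the rows of R and R1 are mod p
   multiples of one isotropic vector c.  As p is odd, c determines the
   p-neighbour of Z^n, which forces p^2 | R R1^T = l^2 U.

   The prime 2 does not divide l.  The moments h k = e^T S^k e vanish for k odd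
   and are even for k > 0.  With t the parity of n, the vectors S^(t+a) e,
   a < n/2, lie in the kernel of W^T mod 2, and det W = 2^(n/2) m with m odd
   makes the Hankel matrix h (2(t+a+b)) / 2 invertible mod 2 and this kernel of
   dimension at most n/2.  So a row v of R is mod 2 a combination of these
   vectors with coefficients y, and v S^(2k) v^T = 0 mod 4 turns into Hankel
   equations in y, whence y = 0 and v = 0 mod 2. *)

(** * Divisibility of integer matrices and reduction modulo a prime *)

Definition dvdmx (d : int) {m n} (A : 'M[int]_(m, n)) : Prop :=
  forall i j, (d %| A i j)%Z.

Lemma dvdmxP {d : int} {m n} {A : 'M[int]_(m, n)} :
  dvdmx d A <-> exists X, A = d *: X.
Proof.
split=> [dA|[X ->] i j]; last by rewrite mxE dvdz_mulr.
exists (\matrix_(i, j) (A i j %/ d)%Z); apply/matrixP=> i j.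
by rewrite !mxE mulrC divzK.
Qed.

Lemma dvdmxMr d m n q (A : 'M[int]_(m, n)) (B : 'M[int]_(n, q)) :
  dvdmx d A -> dvdmx d (A *m B).
Proof.
by case/dvdmxP=> X ->; apply/dvdmxP; exists (X *m B); rewrite scalemxAl.
Qed.

Local Notation modp p := (map_mx (intr : int -> 'F_p)).

Lemma modp_eq0 p m n (A : 'M[int]_(m, n)) :
  prime p -> modp p A = 0 <-> dvdmx p%:Z A.
Proof.
move=> p_pr; split=> [/matrixP A0 i j | dA].
  by rewrite (dvdz_pcharf (pchar_Fp p_pr)); have:= A0 i j; rewrite !mxE => ->.
apply/matrixP=> i j; rewrite !mxE; apply/eqP.
by rewrite -(dvdz_pcharf (pchar_Fp p_pr)); apply: dA.
Qed.

Lemma modp_surj p m n (A : 'M['F_p]_(m, n)) :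
  exists B : 'M[int]_(m, n), modp p B = A.
Proof.
exists (map_mx (fun x : 'F_p => (x : nat)%:Z) A).
by apply/matrixP=> i j; rewrite !mxE -pmulrn natr_Zp.
Qed.

(** Row reduction mod p lifts to an integer matrix [T] with [\det T] prime to p. All rows of
    [T *m W] from index [r] on are divisible by p, and each contributes a factor p to the
    determinant. *)
Lemma corank_dvd_det p n (W : 'M[int]_n) :
  prime p -> ((p ^ (n - \rank (modp p W)))%N%:Z %| \det W)%Z.
Proof.
move=> p_pr; set M := modp p W; set r := \rank M.
have [T TL] := modp_surj (invmx (col_ebase M)).
have TM : modp p (T *m W) = pid_mx r *m row_ebase M.
  rewrite map_mxM TL -[modp p W]mulmx_ebase !mulmxA.
  by rewrite mulVmx ?col_ebase_unit ?mul1mx.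
pose d := \row_(i < n) (if (i < r)%N then 1 else p%:Z).
have [X TWX] : exists X, T *m W = diag_mx d *m X.
  exists (\matrix_(i, j)
    (if (i < r)%N then (T *m W) i j else ((T *m W) i j %/ p)%Z)).
  apply/matrixP=> i j; rewrite mul_diag_mx [RHS]mxE [X in _ = _ * X]mxE [d _ _]mxE.
  case: ltnP => [|le_ri]; first by rewrite mul1r.
  rewrite mulrC divzK // (dvdz_pcharf (pchar_Fp p_pr)).
  have:= congr1 (fun Z : 'M_n => Z i j) TM; rewrite [LHS]mxE => ->.
  rewrite mxE big1 // => k _.
  by rewrite mxE ltnNge le_ri andbF mul0r.
have copT : coprimez (p ^ (n - r))%N%:Z (\det T).
  rewrite coprimezE /= coprimeXl // prime_coprime //.
  change (~~ (p%:Z %| \det T)%Z).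
  rewrite (dvdz_pcharf (pchar_Fp p_pr)) -det_map_mx.
  by rewrite TL -unitfE -unitmxE unitmx_inv col_ebase_unit.
rewrite -(Gauss_dvdzr _ copT) -det_mulmx TWX det_mulmx det_diag dvdz_mulr //.
suff -> : \prod_(i < n) d 0 i = (p ^ (n - r))%N%:Z by [].
have ler : (r <= n)%N by exact: rank_leq_row.
rewrite (eq_bigr (fun i : 'I_n => if (i < r)%N then 1 else p%:Z)); last first.
  by move=> i _; rewrite mxE.
rewrite -(big_mkord xpredT (fun i => if (i < r)%N then 1 else p%:Z)).
rewrite (big_cat_nat (leq0n r) ler) /= big_nat_cond big1 ?mul1r; last first.
  by move=> i /andP[/andP[_ ->]].
rewrite big_nat_cond (eq_bigr (fun=> p%:Z)); last first.
  by move=> i /andP[/andP[]]; rewrite leqNgt => /negbTE ->.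
by rewrite -big_nat_cond prodr_const_nat -rmorphXn /= ?natrXE.
Qed.

(** The determinant bounds the corank of [W] mod p by k, so k independent rows in the left kernel
    already span it; [Y] lifts the coordinates of [V]. *)
Lemma kernel_mod_lift p n k (W : 'M[int]_n) (B : 'M[int]_(k, n)) (m : nat)
    (V : 'M[int]_(m, n)) :
  prime p -> ~~ ((p ^ k.+1)%N%:Z %| \det W)%Z ->
  (forall y : 'rV_k, dvdmx p%:Z (y *m B) -> dvdmx p%:Z y) ->
  dvdmx p%:Z (B *m W) -> dvdmx p%:Z (V *m W) ->
  exists Y X, V = Y *m B + p%:Z *: X.
Proof.
move=> p_pr ndet freeB BW VW.
have freeB' : row_free (modp p B).
  rewrite -kermx_eq0; apply/eqP/row_matrixP=> i; rewrite row0.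
  have [y yE] := modp_surj (row i (kermx (modp p B))).
  rewrite -yE; apply/modp_eq0 => //; apply/freeB/modp_eq0 => //.
  by rewrite map_mxM yE -row_mul mulmx_ker row0.
have [le_r|] := leqP (n - \rank (modp p W)) k; last first.
  move=> lt_k; case/negP: ndet; apply: dvdz_trans (corank_dvd_det W p_pr).
  by rewrite dvdzE /= dvdn_exp2l.
have sBK : (modp p B <= kermx (modp p W))%MS.
  by apply/sub_kermxP; rewrite -map_mxM; apply/modp_eq0.
have sVK : (modp p V <= kermx (modp p W))%MS.
  by apply/sub_kermxP; rewrite -map_mxM; apply/modp_eq0.
have : (kermx (modp p W) <= modp p B)%MS.
  by rewrite -(geq_leqif (mxrank_leqif_sup sBK)) mxrank_ker (eqP freeB').
move=> /(submx_trans sVK) /submxP[Y0 VE].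
have [Y YE] := modp_surj Y0.
have /dvdmxP[X XE] : dvdmx p%:Z (V - Y *m B).
  by apply/modp_eq0; rewrite // map_mxB map_mxM YE -VE subrr.
by exists Y, X; rewrite -XE addrC subrK.
Qed.

(** * Walk vectors and moments of a skew-symmetric matrix *)

Definition walk_vec {n} (S : 'M[int]_n) (k : nat) : 'cV[int]_n :=
  S ^+ k *m const_mx 1.

Definition walk {n} (S : 'M[int]_n) : 'M[int]_n :=
  \matrix_(i, j) walk_vec S j i 0.

Definition moment {n} (S : 'M[int]_n) (k : nat) : int :=
  ((const_mx 1 : 'cV[int]_n)^T *m walk_vec S k) 0 0.

Lemma tr_skewX n (S : 'M[int]_n) k : S^T = - S -> (S ^+ k)^T = (-1) ^+ k *: S ^+ k.
Proof.
move=> skewS; elim: k => [|k IHk]; first by rewrite !expr0 scale1r trmx1.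
rewrite exprSr trmx_mul skewS IHk mulNmx -scalemxAr -scaleNr.
by rewrite -[S ^+ k * S]exprSr (exprS (-1) k) mulN1r exprS.
Qed.

Lemma walk_vec_dot n (S : 'M[int]_n) i j : S^T = - S ->
  ((walk_vec S i)^T *m walk_vec S j) 0 0 = (-1) ^+ i * moment S (i + j).
Proof.
move=> skewS; rewrite /moment /walk_vec trmx_mul tr_skewX // -scalemxAr -scalemxAl.
by rewrite [LHS]mxE -mulmxA [S ^+ i *m _]mulmxA (exprD S i j).
Qed.

(** Transposing a 1 by 1 matrix changes nothing, but turns S^k into (-1)^k S^k. *)
Lemma moment_odd n (S : 'M[int]_n) k : S^T = - S -> odd k -> moment S k = 0.
Proof.
move=> skewS k_odd; suff : moment S k = - moment S k by lia.
have {1}-> : moment S k = ((walk_vec S k)^T *m walk_vec S 0) 0 0.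
  by rewrite /moment -[_ *m _]trmxK mxE trmx_mul trmxK /walk_vec expr0 mul1mx.
by rewrite walk_vec_dot // addn0 -signr_odd k_odd mulN1r.
Qed.

Lemma dvd2_sqr_sub (z : int) : (2 %| z * z - z)%Z.
Proof.
have [q [->|->]] : exists q, z = q * 2 \/ z = q * 2 + 1.
  by exists (z %/ 2)%Z; lia.
  by apply/dvdzP; exists (q * (q * 2 - 1)); ring.
by apply/dvdzP; exists (q * (q * 2 + 1)); ring.
Qed.

Lemma dot_self_mod2 n (x : 'cV[int]_n) :
  (2 %| (x^T *m x) ord0 ord0 - ((const_mx 1 : 'cV[int]_n)^T *m x) ord0 ord0)%Z.
Proof.
rewrite !mxE -sumrB; apply: rpred_sum => i _.
by rewrite !mxE mul1r dvd2_sqr_sub.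
Qed.

(** For even k > 0 and x = S^(k/2) e, the moment is x^T x up to sign, congruent mod 2 to e^T x, the
    moment of index k/2. The descent ends at an odd index, or at index 0 with n even, where the
    moment is n. *)
Lemma moment_even n (S : 'M[int]_n) k :
  S^T = - S -> (odd n <= k)%N -> (2 %| moment S k)%Z.
Proof.
move=> skewS; elim/ltn_ind: k => k IHk le_k.
have [k_odd|k_even] := boolP (odd k); first by rewrite moment_odd ?dvdz0.
have [k0|k_gt0] := posnP k.
  rewrite k0 in le_k *; rewrite /moment /walk_vec expr0 mul1mx !mxE.
  rewrite (eq_bigr (fun=> 1)) => [|i _]; last by rewrite !mxE mulr1.
  rewrite sumr_const card_ord; lia.
have := dot_self_mod2 (walk_vec S k./2); rewrite walk_vec_dot // -/(moment _ _).
rewrite addnn even_halfK //; have := IHk k./2; rewrite -[(-1) ^+ _]signr_odd.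
by case: (odd k./2); rewrite ?expr0 ?expr1; lia.
Qed.

(** * The prime 2: quadratic forms modulo 4 and the kernel of the walk matrix *)

Lemma sum_sym2 (R : nzRingType) r (f : 'I_r -> 'I_r -> R) :
  (forall a b, f a b = f b a) ->
  \sum_a \sum_b f a b =
  \sum_a f a a + (\sum_(a < r) \sum_(b < r | (a < b)%N) f a b) *+ 2.
Proof.
move=> fC; rewrite mulr2n.
have {2}-> : \sum_(a < r) \sum_(b < r | (a < b)%N) f a b
    = \sum_(a < r) \sum_(b < r | (b < a)%N) f a b.
  rewrite (exchange_big_dep xpredT) //=; apply: eq_bigr => a _.
  by apply: eq_bigr => b _; rewrite fC.
rewrite -!big_split; apply: eq_bigr => a _ /=.
rewrite (bigID (fun b : 'I_r => (a < b)%N)) /= addrCA; congr (_ + _).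
rewrite (bigD1 a) ?ltnn //=; congr (_ + _); apply: eq_bigl => b.
by rewrite -leqNgt ltn_neqAle andbC.
Qed.

(** Off-diagonal terms are even and occur in equal pairs; on the diagonal, both G_aa and y_a^2 - y_a
    are even. Thus the quadratic form is linear in y mod 4. *)
Lemma quad_mod4 r (G : 'M[int]_r) (y : 'rV[int]_r) :
  G^T = G -> dvdmx 2 G ->
  (4 %| (y *m G *m y^T) ord0 ord0 - \sum_a y ord0 a * G a a)%Z.
Proof.
move=> symG /dvdmxP[H GE].
have -> : (y *m G *m y^T) 0 0 = \sum_a \sum_b y 0 b * G b a * y 0 a.
  by rewrite mxE; apply: eq_bigr => a _; rewrite !mxE mulr_suml.
rewrite sum_sym2 => [|a b]; last by rewrite -{1}symG mxE; ring.
rewrite addrAC -sumrB; apply: rpredD.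
  apply: rpred_sum => a _.
  rewrite GE mxE.
  rewrite (_ : _ - _ = 2 * H a a * (y ord0 a * y ord0 a - y ord0 a)); last by ring.
  by rewrite (_ : 4 = 2 * 2) // dvdz_mul ?dvdz_mulr ?dvd2_sqr_sub.
rewrite -[_ *+ 2]mulr_natr (_ : 4%:R = 2%:R * 2%:R :> int) //; apply: dvdz_mul => //.
apply: rpred_sum => a _.
apply: rpred_sum => b _.
by rewrite GE mxE mulrAC dvdz_mull // dvdz_mulr.
Qed.

(* When n is odd the walk vector e itself is left out: e^T e = n is odd. *)
Definition walk_rows {n} (S : 'M[int]_n) : 'M[int]_(n./2, n) :=
  \matrix_(a, i) walk_vec S (odd n + a) i 0.

Lemma row_walk_rows n (S : 'M[int]_n) a :
  row a (walk_rows S) = (walk_vec S (odd n + a))^T.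
Proof. by apply/rowP=> i; rewrite !mxE. Qed.

Lemma col_walk n (S : 'M[int]_n) j : col j (walk S) = walk_vec S j.
Proof. by apply/colP=> i; rewrite !mxE. Qed.

Lemma mulmx_entry m n q (A : 'M[int]_(m, n)) (B : 'M[int]_(n, q)) i j :
  (A *m B) i j = (row i A *m col j B) 0 0.
Proof. by rewrite !mxE; apply: eq_bigr => k _; rewrite !mxE. Qed.

Lemma walk_gram n (S : 'M[int]_n) i j : S^T = - S ->
  ((walk S)^T *m walk S) i j = (-1) ^+ i * moment S (i + j).
Proof.
by move=> skewS; rewrite mulmx_entry -tr_col !col_walk walk_vec_dot.
Qed.

(** S^(2k) is symmetric, so the two cross terms between y B and 2x agree and add up to a multiple of
    4. What remains is a form in y with even Hankel entries up to sign, to which [quad_mod4]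
    applies. *)
Lemma quad_walk_rows n (S : 'M[int]_n) k (y : 'rV_(n./2)) (x v : 'rV_n) :
  S^T = - S -> v = y *m walk_rows S + 2 *: x ->
  (4 %| (v *m S ^+ k.*2 *m v^T) ord0 ord0)%Z ->
  (4 %| \sum_a y ord0 a * moment S ((odd n + a + k).*2))%Z.
Proof.
move=> skewS vE; set B := walk_rows S; set T := S ^+ k.*2.
have symT : T^T = T by rewrite tr_skewX // -signr_odd odd_double scale1r.
have GE a b : (B *m T *m B^T) a b
    = (-1) ^+ (odd n + a)%N * moment S ((odd n + a) + (k.*2 + (odd n + b))).
  rewrite mulmx_entry -tr_row row_mul !row_walk_rows trmxK -mulmxA.
  rewrite /walk_vec [T *m _]mulmxA -[T *m _]/(T * _) -exprD.
  by rewrite -walk_vec_dot.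
set G := B *m T *m B^T in GE.
have symG : G^T = G by rewrite /G !trmx_mul trmxK symT mulmxA.
have evenM i : (odd n <= i)%N -> (2 %| moment S i)%Z by exact: moment_even.
have evenG : dvdmx 2 G.
  by move=> a b; rewrite GE dvdz_mull // evenM // -addnA leq_addr.
have := quad_mod4 y symG evenG.
have -> : (v *m T *m v^T) ord0 ord0 = (y *m G *m y^T) ord0 ord0
   + 4 * ((y *m B *m T *m x^T) ord0 ord0 + (x *m T *m x^T) ord0 ord0).
  have cross : (x *m T *m (y *m B)^T) ord0 ord0 = (y *m B *m T *m x^T) ord0 ord0.
    by rewrite -[in LHS](trmxK (_ *m _)) mxE !trmx_mul !trmxK symT !mulmxA.
  have -> : v *m T *m v^T = y *m B *m T *m (y *m B)^T + 2 *: (y *m B *m T *m x^T)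
      + 2 *: (x *m T *m (y *m B)^T) + 4 *: (x *m T *m x^T).
    rewrite vE [_^T]raddfD /= [(2 *: x)^T]linearZ /= mulmxDl mulmxDr !mulmxDl.
    rewrite -!scalemxAr -!scalemxAl !addrA scalerA -natrM.
    by rewrite -/B; congr (_ + _); rewrite addrAC.
  have mxD (A C : 'M[int]_1) : (A + C) ord0 ord0 = A ord0 ord0 + C ord0 ord0.
    by rewrite mxE.
  have mxZ c (A : 'M[int]_1) : (c *: A) ord0 ord0 = c * A ord0 ord0.
    by rewrite mxE.
  rewrite !mxD !mxZ cross /G trmx_mul !mulmxA; ring.
have diagE : (4 %|
    \sum_a (y ord0 a * moment S ((odd n + a + k).*2) - y ord0 a * G a a))%Z.
  apply: rpred_sum => a _; rewrite -mulrBr dvdz_mull // GE.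
  have -> : (odd n + a + (k.*2 + (odd n + a)) = (odd n + a + k).*2)%N by lia.
  have le_n : (odd n <= (odd n + a + k).*2)%N by lia.
  (* Changing the sign of an even moment does not change it mod 4. *)
  have := evenM _ le_n; rewrite -(signr_odd _ (odd n + a)%N).
  case/dvdzP=> q ->; case: (odd (odd n + a)%N) => /=; apply/dvdzP.
    by exists q; ring.
  by exists 0; ring.
move: diagE; rewrite sumrB.
set u := \sum_a _; set u' := \sum_a _; set q := (y *m G *m y^T) _ _.
set z := (X in 4 * X).
clearbody u u' q z => /dvdzP[c dc] /dvdzP[a da] /dvdzP[b db].
apply/dvdzP; exists (c - a + b - z).
have -> : u = (u - u') - (q - u') + (q + 4 * z) - 4 * z by ring.
by rewrite dc da db; ring.
Qed.

(* All moments except [moment S 0 = n] for n odd are even; this single odd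
   entry is why the first row is not halved in that case. *)
Lemma walk_gram_halved n (S : 'M[int]_n) (m : int) :
  S^T = - S -> \det (walk S) = 2 ^+ n./2 * m ->
  exists2 H : 'M_n, \det H = m ^+ 2 &
    (walk S)^T *m walk S = diag_mx (\row_i if (i < odd n)%N then 1 else 2) *m H.
Proof.
move=> skewS detW; set d := \row_i _.
have [H WH] : exists H, (walk S)^T *m walk S = diag_mx d *m H.
  exists (\matrix_(i, j) (((walk S)^T *m walk S) i j %/ d ord0 i)%Z).
  apply/matrixP=> i j; rewrite mul_diag_mx [RHS]mxE [X in _ = _ * X]mxE mulrC.
  rewrite divzK // walk_gram // mxE.
  case: ltnP => [_ | le_i]; first exact: dvd1z.
  by apply: dvdz_mull; apply: moment_even => //; apply: leq_trans (leq_addr _ _).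
exists H => //; have := congr1 (fun A => \det A) WH.
rewrite !det_mulmx det_tr det_diag detW.
(* Exactly n - [odd n] = 2 [n./2] diagonal entries equal 2. *)
have -> : \prod_i d 0 i = (2 ^+ n./2) ^+ 2.
  rewrite (eq_bigr (fun i : 'I_n => if (i < odd n)%N then 1 else 2)); last first.
    by move=> i _; rewrite mxE.
  have ler : (odd n <= n)%N by lia.
  rewrite -(big_mkord xpredT (fun i => if (i < odd n)%N then 1 else 2)).
  rewrite (big_cat_nat (leq0n _) ler) /= big_nat_cond big1 ?mul1r; last first.
    by move=> i /andP[/andP[_ ->]].
  rewrite big_nat_cond (eq_bigr (fun=> 2)); last first.
    by move=> i /andP[/andP[]]; rewrite leqNgt => /negbTE ->.
  rewrite -big_nat_cond prodr_const_nat -exprM; congr (_ ^+ _); lia.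
rewrite mulrACA -!expr2 => /mulfI-> //.
by rewrite !expf_neq0.
Qed.

(* The halved Gram matrix has an odd determinant, and it couples only indices
   of equal parity because odd moments vanish; so its Hankel block on the
   indices congruent to n mod 2 is invertible mod 2. *)
Lemma moment_forms_free n (S : 'M[int]_n) (m : int) (y : 'rV_(n./2)) :
  S^T = - S -> \det (walk S) = 2 ^+ n./2 * m -> odd `|m|%N ->
  (forall k, (4 %| \sum_a y ord0 a * moment S ((odd n + a + k).*2))%Z) ->
  dvdmx 2 y.
Proof.
move=> skewS detW odd_m hy; have [H detH WH] := walk_gram_halved skewS detW.
have lt_pos (a : 'I_(n./2)) : (a.*2 + odd n < n)%N by have := ltn_ord a; lia.
pose f a := Ordinal (lt_pos a).
pose P : 'M[int]_(n./2, n) := \matrix_(a, i) (i == f a)%:R.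
have mulP q (A : 'M[int]_(n, q)) : P *m A = \matrix_(a, j) A (f a) j.
  apply/matrixP=> a j; rewrite !mxE (bigD1 (f a)) //= mxE eqxx mul1r big1 ?addr0 //.
  by move=> i /negbTE ne_i; rewrite mxE ne_i mul0r.
(* [P] places y on the indices congruent to n mod 2. Columns of the other parity vanish because only
   odd moments occur there; the remaining columns are the hypothesis, up to sign. *)
have : dvdmx 4 (y *m P *m ((walk S)^T *m walk S)).
  move=> i j; rewrite -mulmxA mulP mxE ord1.
  under eq_bigr => a _ do rewrite mxE walk_gram //=.
  have [odd_j | even_j] := boolP (odd (odd n + j)).
    rewrite big1 // => a _; rewrite moment_odd ?mulr0 //; lia.
  have [k jE] : exists k, nat_of_ord j = (k.*2 + odd n)%N.
    by exists (j./2); lia.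
  have -> : \sum_a y 0 a * ((-1) ^+ (a.*2 + odd n) * moment S (a.*2 + odd n + j))
      = (-1) ^+ odd n * \sum_a y 0 a * moment S ((odd n + a + k).*2).
    rewrite mulr_sumr; apply: eq_bigr => a _.
    rewrite mulrCA -signr_odd oddD odd_double /= oddb; congr (_ * (_ * moment S _)).
    by rewrite jE; lia.
  exact/dvdz_mull/hy.
rewrite WH mulmxA -[y *m P *m _]mulmxA mulP.
(* The selected indices are at least [odd n], so the diagonal matrix doubles every row of [P];
   cancelling this 2 leaves y P H even, and H has odd determinant m^2. *)
have -> : \matrix_(a, j) diag_mx (\row_(i < n) if (i < odd n)%N then 1 else 2) (f a) j
     = 2 *: P.
  apply/matrixP=> a j; rewrite !mxE /= ltnNge leq_addl /= [j == _]eq_sym.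
  by case: (_ == j); rewrite ?mulr1 ?mulr0.
rewrite -scalemxAr -scalemxAl => d4.
have d2 : dvdmx 2 (y *m P *m H).
  move=> i j; have := d4 i j; rewrite mxE (_ : 4%:R = 2%:R * 2%:R :> int) //.
  by rewrite dvdz_mul2l.
have {}d2 : dvdmx 2 (y *m P).
  have := dvdmxMr (\adj H) d2; rewrite -mulmxA mul_mx_adj mul_mx_scalar detH => d2m i j.
  have := d2m i j; rewrite mxE Gauss_dvdzr // coprimezE abszX coprime2n.
  by rewrite oddX odd_m orbT.
move=> i a; have := d2 i (f a); rewrite mxE (bigD1 a) //= mxE eqxx mulr1 big1 ?addr0 //.
move=> b ne_b; rewrite mxE; case: eqP => [/(congr1 val) /=|]; last by rewrite mulr0.
by move=> eq_ab; case/eqP: ne_b; apply: val_inj => /=; lia.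
Qed.

(** The walk rows form a basis of the left kernel of [walk S] mod 2, and the condition mod 4 on each
    row of [V] kills its coordinates in that basis. *)
Lemma even_kernel n (S : 'M[int]_n) (m : int) q (V : 'M[int]_(q, n)) :
  S^T = - S -> \det (walk S) = 2 ^+ n./2 * m -> odd `|m|%N ->
  dvdmx 2 (V *m walk S) ->
  (forall k, dvdmx 4 (V *m S ^+ k *m V^T)) ->
  dvdmx 2 V.
Proof.
move=> skewS detW odd_m VW VSV.
(* A relation y B = 2x is the case v = 0 of [quad_walk_rows], so independence follows from the same
   moment equations. *)
have free (y : 'rV_(n./2)) : dvdmx 2 (y *m walk_rows S) -> dvdmx 2 y.
  case/dvdmxP=> x yE; apply: (moment_forms_free skewS detW odd_m) => k.
  apply: (@quad_walk_rows _ _ _ _ (- x) 0) => //.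
    by rewrite yE scalerN subrr.
  by rewrite !mul0mx mxE dvdz0.
have [||Y [X VE]] := @kernel_mod_lift 2 n _ (walk S) (walk_rows S) _ V isT _ free _ VW.
- rewrite detW dvdzE abszM abszX expnSr.
  by rewrite dvdn_pmul2l ?expn_gt0 // dvdn2 odd_m.
- move=> a j; rewrite mulmx_entry row_walk_rows col_walk walk_vec_dot //.
  by apply: dvdz_mull; apply: moment_even => //; rewrite -addnA leq_addr.
have Y2 : dvdmx 2 Y.
  suff Y2 i : dvdmx 2 (row i Y) by move=> i j; have := Y2 i 0 j; rewrite mxE.
  apply: (moment_forms_free skewS detW odd_m) => k.
  apply: (@quad_walk_rows _ _ _ _ (row i X) (row i V)) => //.
    by rewrite {1}VE linearD linearZ /= row_mul.
  have := VSV k.*2 i i.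
  by rewrite [in X in (_ %| X)%Z -> _]mulmx_entry -tr_row row_mul.
rewrite VE => i j; rewrite mxE; apply: rpredD; first exact: dvdmxMr.
by rewrite mxE dvdz_mulr.
Qed.

(** * Odd primes: the kernel line and its neighbour lattice *)

Lemma not_dvdmx d m n (A : 'M[int]_(m, n)) :
  ~ dvdmx d A -> exists i j, ~~ (d %| A i j)%Z.
Proof.
move=> ndA; have [/forallP dA|] := boolP [forall i, forall j, (d %| A i j)%Z].
  by case: ndA => i j; have /forallP := dA i.
rewrite negb_forall => /existsP[i]; rewrite negb_forall => /existsP[j].
by exists i, j.
Qed.

Lemma Euclid_dvdzM p (a b : int) :
  prime p -> (p%:Z %| a * b)%Z = (p%:Z %| a)%Z || (p%:Z %| b)%Z.
Proof. by move=> p_pr; rewrite !dvdzE abszM Euclid_dvdM. Qed.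

Lemma gram_expand (R : comNzRingType) q q1 n (c : 'rV[R]_n) (p : R)
    (al : 'cV_q) (be : 'cV_q1) (X : 'M_(q, n)) (Y : 'M_(q1, n)) a b :
  ((al *m c + p *: X) *m (be *m c + p *: Y)^T) a b =
  al a 0 * be b 0 * (c *m c^T) 0 0
  + p * (al a 0 * (c *m Y^T) 0 b + be b 0 * (c *m X^T) 0 a)
  + p ^+ 2 * (X *m Y^T) a b.
Proof.
rewrite !mxE mulrDr !mulr_sumr -!big_split /=.
by apply: eq_bigr => k _; rewrite !mxE !big_ord1 ?mxE; ring.
Qed.

(** The kernel mod p is a line spanned by a row c of R, so R = al c + p X and R1 = be c + p Y. Once
    c X^T and c Y^T vanish mod p, every term of [gram_expand] for R R1^T is divisible by p^2. *)
Lemma odd_neighbour p q q1 n (W : 'M[int]_n)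
    (R : 'M[int]_(q, n)) (R1 : 'M[int]_(q1, n)) :
  prime p -> odd p -> ~~ ((p ^ 2)%N%:Z %| \det W)%Z ->
  dvdmx p%:Z (R *m W) -> dvdmx p%:Z (R1 *m W) ->
  ~ dvdmx p%:Z R -> ~ dvdmx p%:Z R1 ->
  dvdmx (p%:Z ^+ 2) (R *m R^T) -> dvdmx (p%:Z ^+ 2) (R1 *m R1^T) ->
  dvdmx (p%:Z ^+ 2) (R *m R1^T).
Proof.
move=> p_pr p_odd ndetW RW R1W /not_dvdmx[i0 [j0 ndR]] ndR1 RR R1R1.
have p_neq0 : p%:Z != 0 by rewrite eqz_nat -lt0n prime_gt0.
pose c := row i0 R.
have cW : dvdmx p%:Z (c *m W) by move=> i j; rewrite -row_mul mxE.
have free (y : 'rV_1) : dvdmx p%:Z (y *m c) -> dvdmx p%:Z y.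
  move=> yc i j; have := yc i j0; rewrite mxE big_ord1 Euclid_dvdzM // !ord1 mxE.
  by rewrite (negbTE ndR) orbF.
have [al [X RE]] := kernel_mod_lift p_pr ndetW free cW RW.
have [be [Y R1E]] := kernel_mod_lift p_pr ndetW free cW R1W.
(* Writing c in the same shape lets [gram_expand] compute c R^T = (c c^T) al^T + p c X^T, a row of R
   R^T. *)
have cE : c = 1%:M *m c + p%:Z *: 0 by rewrite mul1mx scaler0 addr0.
have ccE : (c *m c^T) 0 0 = (R *m R^T) i0 i0.
  by rewrite [RHS]mulmx_entry -tr_row.
have /dvdzP[s' sE] : (p%:Z ^+ 2 %| (c *m c^T) ord0 ord0)%Z by rewrite ccE.
have mx00 m k i j : (0 : 'M[int]_(m, k)) i j = 0 by rewrite mxE.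
have mx11 : (1%:M : 'M[int]_1) 0 0 = 1 by rewrite mxE.
have dX a : (p%:Z %| (c *m X^T) ord0 a)%Z.
  have /dvdzP[u uE] := RR i0 a.
  have := gram_expand c p%:Z 1%:M al 0 X 0 a; rewrite -cE -RE.
  have -> : (c *m R^T) 0 a = (R *m R^T) i0 a by rewrite -row_mul mxE.
  rewrite trmx0 mulmx0 mul0mx !mx00 mx11 uE sE => eq_p.
  apply/dvdzP; exists (u - al a 0 * s'); apply: (mulfI p_neq0).
  rewrite [LHS](_ : _ = u * p%:Z ^+ 2 - al a 0 * (s' * p%:Z ^+ 2)); first by ring.
  by rewrite eq_p; ring.
have [b0 nd_be] : exists b, ~~ (p%:Z %| be b ord0)%Z.
  have [|b [z]] := @not_dvdmx p%:Z _ _ be; last by rewrite (ord1 z); exists b.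
  move=> d_be; apply: ndR1 => b k; rewrite R1E mxE; apply: rpredD.
    exact: dvdmxMr.
  by rewrite mxE dvdz_mulr.
have dYY b b' : (p%:Z %|
    be b ord0 * (c *m Y^T) ord0 b' + be b' ord0 * (c *m Y^T) ord0 b)%Z.
  have /dvdzP[u uE] := R1R1 b b'.
  have := gram_expand c p%:Z be be Y Y b b'; rewrite -R1E uE sE => eq_p.
  apply/dvdzP; exists (u - be b 0 * be b' 0 * s' - (Y *m Y^T) b b').
  apply: (mulfI p_neq0).
  rewrite [LHS](_ : _ = u * p%:Z ^+ 2 - be b 0 * be b' 0 * (s' * p%:Z ^+ 2)
     - p%:Z ^+ 2 * (Y *m Y^T) b b'); first by ring.
  by rewrite eq_p; ring.
(* c need not be a row of R1, so c Y^T is reached through R1 R1^T: the diagonal entry at [b0] gives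
   2 be_b0 (c Y^T)_b0 = 0 mod p with p odd, and the entries (b0, b) give the rest. *)
have dY b : (p%:Z %| (c *m Y^T) ord0 b)%Z.
  have dY0 : (p%:Z %| (c *m Y^T) ord0 b0)%Z.
    have := dYY b0 b0; rewrite -mulr2n -mulr_natr !Euclid_dvdzM // (negbTE nd_be) /=.
    case/orP => //; rewrite dvdzE /= dvdn_prime2 // => /eqP p2.
    by rewrite p2 in p_odd.
  suff: (p%:Z %| be b0 ord0 * (c *m Y^T) ord0 b)%Z.
    by rewrite Euclid_dvdzM // (negbTE nd_be).
  rewrite -[X in (_ %| X)%Z](addrK (be b ord0 * (c *m Y^T) ord0 b0)).
  by apply: rpredB; [apply: dYY | apply: dvdz_mull].
move=> a b; have /dvdzP[u uE] := dX a; have /dvdzP[v vE] := dY b.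
rewrite RE R1E gram_expand sE uE vE; apply/dvdzP.
exists (al a 0 * be b 0 * s' + al a 0 * v + be b 0 * u + (X *m Y^T) a b); ring.
Qed.

(** * Combining the primes, and integral orthogonal matrices *)

(** As l is square-free, the p-part of l^2 is p^2 for each prime p dividing l. *)
Lemma squarefree_sqr_dvd (l x : nat) : (0 < l)%N ->
  (forall p, prime p -> (p %| l)%N -> ~~ (p ^ 2 %| l)%N) ->
  (forall p, prime p -> (p %| l)%N -> (p ^ 2 %| x)%N) ->
  (l ^ 2 %| x)%N.
Proof.
move=> l_gt0 sqf dx; apply/dvdn_partP; first by rewrite expn_gt0 l_gt0.
move=> p; rewrite mem_primes => /and3P[p_pr _]; rewrite Euclid_dvdX // andbT => p_l.
apply: dvdn_trans (dx p p_pr p_l); rewrite p_part lognX dvdn_exp2l //.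
have := sqf p p_pr p_l; rewrite pfactor_dvdn // -ltnNge; lia.
Qed.

(** Each row has sum and sum of squares 1, so the nonnegative integers u^2 - u sum to 0 and all
    entries are 0 or 1. Each row then has a single 1, and orthogonality puts these in distinct
    columns. *)
Lemma perm_of_int_orthogonal n (U : 'M[int]_n) :
  U *m U^T = 1%:M -> U *m const_mx 1 = const_mx 1 :> 'cV_n ->
  exists s : 'S_n, U = perm_mx s.
Proof.
move=> UU Ue.
have gramU i k : \sum_j U i j * U k j = (i == k)%:R.
  have := congr1 (fun A : 'M_n => A i k) UU; rewrite !mxE => <-.
  by apply: eq_bigr => j _; rewrite mxE.
have sumU i : \sum_j U i j = 1.
  have := congr1 (fun A : 'cV_n => A i 0) Ue; rewrite !mxE => <-.
  by apply: eq_bigr => j _; rewrite mxE mulr1.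
have sqr_ge (z : int) : 0 <= z * z - z by nia.
have U01 i j : U i j = 0 \/ U i j = 1.
  have : \sum_j (U i j * U i j - U i j) = 0 by rewrite sumrB gramU sumU eqxx subrr.
  move/eqP; rewrite psumr_eq0 // => /allP/(_ j (mem_index_enum j))/=.
  rewrite -[X in _ - X]mulr1 -mulrBr mulf_eq0 subr_eq0.
  by case/orP=> /eqP; [left | right].
have ex1 i : exists j, U i j == 1.
  apply/existsP; apply: contraT; rewrite negb_exists => /forallP U0.
  have := sumU i; rewrite big1 // => j _.
  by case: (U01 i j) => // Uij; have := U0 j; rewrite Uij eqxx.
pose f i := xchoose (ex1 i).
have Uf i : U i (f i) = 1 by apply/eqP/(xchooseP (ex1 i)).
have prod_ge0 i k j : 0 <= U i j * U k j.
  by case: (U01 i j) => ->; case: (U01 k j) => ->.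
have f_inj : injective f.
  move=> i k eq_f; apply/eqP; have := gramU i k; case: eqP => // _.
  rewrite (bigD1 (f i)) //= Uf eq_f Uf => sum0.
  have : 0 < 1 * 1 + \sum_(j | j != f k) U i j * U k j.
    by rewrite ltr_pwDl // sumr_ge0.
  by rewrite sum0.
exists (perm f_inj); apply/matrixP=> i j; rewrite !mxE permE.
case: eqP => [<- | /eqP ne_fj]; first exact: Uf.
have := sumU i; rewrite (bigD1 (f i)) //= Uf (bigD1 j) 1?eq_sym //=.
case: (U01 i j) => -> // sum1.
have : 1 < 1 + (1 + \sum_(k | (k != f i) && (k != j)) U i k).
  rewrite ltrDl ltr_pwDl // sumr_ge0 // => k _.
  by case: (U01 i k) => ->.
by rewrite sum1.
Qed.

(** * Passage from rational to integer matrices *)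

Local Notation toQ := (map_mx (intr : int -> rat)).

Lemma toQ_inj m n : injective (toQ : 'M[int]_(m, n) -> 'M[rat]_(m, n)).
Proof.
move=> A B /matrixP eqAB; apply/matrixP=> i j.
by have := eqAB i j; rewrite !mxE => /intr_inj.
Qed.

Definition skewZ n (arc : rel 'I_n) : 'M[int]_n :=
  \matrix_(i, j) (if arc i j then 1 else if arc j i then -1 else 0).

Lemma skewS_toQ n (arc : rel 'I_n) : skewS arc = toQ (skewZ arc).
Proof. by apply/matrixP=> i j; rewrite !mxE; do 2?case: ifP. Qed.

Lemma skewZ_skew n (arc : rel 'I_n) : oriented arc -> (skewZ arc)^T = - skewZ arc.
Proof.
move=> or_arc; apply/matrixP=> i j; rewrite !mxE.
have := or_arc i j; have := or_arc j i.
by case: (arc i j); case: (arc j i); rewrite ?oppr0 ?opprK // => _ /(_ isT).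
Qed.

Lemma evec_toQ n : evec n = toQ (const_mx 1).
Proof. by rewrite map_const_mx. Qed.

Lemma walk_mx_toQ n (arc : rel 'I_n) : walk_mx arc = toQ (walk (skewZ arc)).
Proof.
apply/matrixP=> i j; rewrite [LHS]mxE [RHS]mxE [walk _ _ _]mxE skewS_toQ evec_toQ.
have <- : toQ (skewZ arc ^+ j) = toQ (skewZ arc) ^+ j.
  by elim: {j}(j : nat) => [|k IHk]; rewrite ?map_mx1 // !exprS map_mxM IHk.
by rewrite -map_mxM [LHS]mxE.
Qed.

(** Here R = l Q^T; the transpose makes R act on walk matrices from the left. *)
Lemma integral_scaling n (Q : 'M[rat]_n) (a b : rel 'I_n) (l : nat) :
  rat_orthogonal Q -> regular Q -> is_level Q l ->
  Q^T *m skewS a *m Q = skewS b ->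
  exists R : 'M[int]_n,
    [/\ toQ R = l%:R *: Q^T, R *m R^T = (l%:Z ^+ 2)%:M,
        R *m skewZ a = skewZ b *m R, R *m const_mx 1 = const_mx l%:Z :> 'cV_n
      & forall p, prime p -> (p %| l)%N -> ~ dvdmx p%:Z R].
Proof.
move=> QQ Qe [l_gt0 [[N NE] minl]] QSQ; exists N^T.
have RE : toQ N^T = l%:R *: Q^T by rewrite -map_trmx -NE linearZ.
have QQ' : Q *m Q^T = 1%:M by apply: mulmx1C.
have QTe : Q^T *m evec n = evec n by rewrite -{1}Qe mulmxA QQ mul1mx.
split=> //.
- apply: toQ_inj; rewrite trmxK map_mxM RE -NE -scalemxAl -scalemxAr QQ scalerA.
  by rewrite map_scalar_mx /= rmorphXn /= expr2 scalemx1.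
- apply: toQ_inj; rewrite !map_mxM RE -!skewS_toQ -QSQ -scalemxAl -scalemxAr.
  by rewrite -!mulmxA QQ' mulmx1.
- apply: toQ_inj; rewrite map_mxM RE -evec_toQ -scalemxAl QTe map_const_mx.
  by apply/matrixP=> i j; rewrite !mxE mulr1.
(* If p divided both l and R, then (l/p) Q would be integral, against the minimality of l. *)
move=> p p_pr /dvdnP[l' lE] /dvdmxP[X NX].
have l'_gt0 : (0 < l')%N by move: l_gt0; rewrite lE; case: (l').
have : (l <= l')%N.
  apply: minl => //; exists X^T; apply: (@scalerI _ _ p%:R).
    by rewrite pnatr_eq0 -lt0n prime_gt0.
  rewrite scalerA -natrM mulnC -lE NE -[N]trmxK NX linearZ /=.
  by apply/matrixP=> i j; rewrite !mxE intrM.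
by rewrite lE leqNgt ltn_Pmulr // prime_gt1.
Qed.

Lemma intertwine_powers n (R S S' : 'M[int]_n) k :
  R *m S = S' *m R -> R *m S ^+ k = S' ^+ k *m R.
Proof.
move=> RS; elim: k => [|k IHk]; first by rewrite !expr0 mulmx1 mul1mx.
rewrite exprSr [S' ^+ _]exprSr -[_ ^+ k * S]/(_ ^+ k *m S).
by rewrite mulmxA IHk -mulmxA RS mulmxA.
Qed.

Lemma scaling_walk n (R S S' : 'M[int]_n) (l : int) :
  R *m S = S' *m R -> R *m const_mx 1 = const_mx l :> 'cV_n ->
  R *m walk S = l *: walk S'.
Proof.
move=> RS Re; apply/matrixP=> i j.
rewrite mulmx_entry col_walk -row_mul /walk_vec mulmxA (intertwine_powers j RS).
rewrite -mulmxA Re !mxE; rewrite mulr_sumr; apply: eq_bigr => k _.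
by rewrite !mxE mulr1 mulrC.
Qed.

Lemma scaling_powers n (R S S' : 'M[int]_n) (l : int) k :
  R *m S = S' *m R -> R *m R^T = (l ^+ 2)%:M ->
  R *m S ^+ k *m R^T = l ^+ 2 *: S' ^+ k.
Proof.
by move=> RS RR; rewrite (intertwine_powers k RS) -mulmxA RR mul_mx_scalar.
Qed.

Lemma prime_sqr_ndvd_det (p r m : nat) : prime p -> odd p -> squarefree m ->
  ~~ (p ^ 2 %| 2 ^ r * m)%N.
Proof.
move=> p_pr p_odd sqf; rewrite Gauss_dvdr; first exact: sqf.
by rewrite coprimeXl // coprimeXr // coprimen2.
Qed.

(** * Integrality of Q^T Q1 and the isomorphism *)

Unset Implicit Arguments.

Theorem theorem1p5 (n : nat) (sigma delta gamma : rel 'I_n)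
    (Q Q1 : 'M[rat]_n) (l : nat) :
  in_Gn sigma -> in_Gn delta -> in_Gn gamma ->
  gen_cospectral sigma delta -> gen_cospectral sigma gamma ->
  gen_cospectral delta gamma ->
  in_calQ sigma Q -> in_calQ sigma Q1 ->
  is_level Q l -> is_level Q1 l ->
  Q^T *m skewS sigma *m Q = skewS delta ->
  Q1^T *m skewS sigma *m Q1 = skewS gamma ->
  isomorphic delta gamma.
Proof.
move=> [or_s [m [detQ [odd_m sqf_m]]]] _ _ _ _ _ [QQ [Qe _]] [QQ1 [Qe1 _]].
move=> lev lev1 QSQ QSQ1; have l_gt0 : (0 < l)%N by case: lev.
have [R [RE RR RS Re ndR]] := integral_scaling QQ Qe lev QSQ.
have [R1 [R1E RR1 RS1 Re1 ndR1]] := integral_scaling QQ1 Qe1 lev1 QSQ1.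
set S := skewZ sigma in RS RS1; have skS : S^T = - S by apply: skewZ_skew.
have detW : \det (walk S) = 2 ^+ n./2 * m.
  apply: (@intr_inj rat); rewrite -det_map_mx -walk_mx_toQ detQ.
  by rewrite intrM rmorphXn.
have RW := scaling_walk RS Re; have RW1 := scaling_walk RS1 Re1.
have dvd_lmx p (A : 'M_n) : (p %| l)%N -> dvdmx p%:Z (l%:Z *: A).
  by move=> p_l i j; rewrite mxE dvdz_mulr.
(* For even l, R W = l W(Delta) vanishes mod 2 and R S^k R^T = l^2 S(Delta)^k mod 4, so
   [even_kernel] would make R even. *)
have odd_l : odd l.
  apply: contraT; rewrite -dvdn2 => l_even; case: (ndR 2%N isT l_even).
  apply: (even_kernel skS detW odd_m); first by rewrite RW; apply: dvd_lmx.
  move=> k; rewrite (scaling_powers k RS RR) => i j; rewrite mxE dvdz_mulr //.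
  by rewrite dvdzE abszX; apply: (@dvdn_exp2r 2 l 2).
have odd_dvd p : (p %| l)%N -> odd p by move=> p_l; apply: dvdn_odd p_l odd_l.
have nd_det p : prime p -> (p %| l)%N -> ~~ ((p ^ 2)%N%:Z %| \det (walk S))%Z.
  move=> p_pr p_l; rewrite detW dvdzE abszM abszX /=.
  by rewrite prime_sqr_ndvd_det ?odd_dvd.
(* If p^2 divides l, the adjugate of W turns R W = 0 mod p^2 into (det W) R = 0 mod p^2; since p^2
   does not divide det W, p divides R. *)
have sqf_l p : prime p -> (p %| l)%N -> ~~ (p ^ 2 %| l)%N.
  move=> p_pr p_l; apply/negP=> p2_l; apply: (ndR p p_pr p_l) => i j.
  have := dvdmxMr (\adj (walk S)) (dvd_lmx (p ^ 2)%N (walk (skewZ delta)) p2_l) i j.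
  rewrite -RW -mulmxA mul_mx_adj mul_mx_scalar mxE => p2_dvd.
  apply: contraT => ndRij; case/negP: (nd_det p p_pr p_l).
  rewrite -(Gauss_dvdzl _ (p := R i j)) // coprimezE coprimeXl //.
  by rewrite prime_coprime.
have dvdU : dvdmx (l%:Z ^+ 2) (R *m R1^T).
  move=> i j; rewrite dvdzE abszX; apply: squarefree_sqr_dvd => // p p_pr p_l.
  suff : dvdmx (p%:Z ^+ 2) (R *m R1^T).
    by move/(_ i j); rewrite dvdzE abszX.
  apply: (odd_neighbour p_pr (odd_dvd p p_l) (nd_det p p_pr p_l)).
  - by rewrite RW; apply: dvd_lmx.
  - by rewrite RW1; apply: dvd_lmx.
  - exact: ndR.
  - exact: ndR1.
  - rewrite RR => i' j'; rewrite mxE; apply: rpredMn.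
    by rewrite /= dvdz_exp2r.
  - rewrite RR1 => i' j'; rewrite mxE; apply: rpredMn.
    by rewrite /= dvdz_exp2r.
have [U UE] := dvdmxP.1 dvdU.
have l_neq0 : l%:R != 0 :> rat by rewrite pnatr_eq0 -lt0n.
have UQ : toQ U = Q^T *m Q1.
  apply: (@scalerI _ _ (l%:R ^+ 2)); first by rewrite expf_neq0.
  have -> : l%:R ^+ 2 *: toQ U = toQ (R *m R1^T).
    by rewrite UE; apply/matrixP=> i j; rewrite !mxE intrM rmorphXn.
  rewrite map_mxM -map_trmx RE R1E linearZ /= trmxK -scalemxAl -scalemxAr.
  by rewrite scalerA.
have QQ1' : Q1 *m Q1^T = 1%:M by apply: mulmx1C.
have UU : U *m U^T = 1%:M.
  apply: toQ_inj; rewrite map_mxM -map_trmx UQ trmx_mul trmxK map_mx1.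
  by rewrite mulmxA -[Q^T *m _ *m _]mulmxA QQ1' mulmx1.
have Ue : U *m const_mx 1 = const_mx 1 :> 'cV_n.
  apply: toQ_inj; rewrite map_mxM -evec_toQ UQ -mulmxA Qe1 -{1}Qe mulmxA QQ.
  by rewrite mul1mx.
have [s sE] := perm_of_int_orthogonal UU Ue.
have sQ : perm_mx s = Q^T *m Q1.
  by rewrite -UQ sE; apply/matrixP=> i j; rewrite !mxE; case: eqP.
(* S(Delta) = U S(Gamma) U^T has the transpose on the right, hence the inverse permutation. *)
exists (s^-1)%g; rewrite tr_perm_mx invgK -tr_perm_mx sQ -QSQ -QSQ1 trmx_mul trmxK.
have E A : Q1 *m (Q1^T *m A) = A :> 'M_n by rewrite mulmxA QQ1' mul1mx.
by rewrite -!mulmxA !E.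
Qed.
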